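(* Let a combined non-degenerate finitely additive Markov chain be given on an arbitrary discrete space $(X,\Sigma_d)$, with Markov operator $A=A_{ca}+A_{pfa}$ and constants $q_1,q_2$, and suppose that $A_{ca}V_{pfa}\subset V_{ca}$. Then for any initial measure $\mu^1\in S_{ba}$, with $\mu^{n+1}=A\mu^n$, for any $n\in\mathbb N$, $$\|\mu^{n+1}_{ca}\|=\mu^{n+1}_{ca}(X)=q_1,\qquad \|\mu^{n+1}_{pfa}\|=\mu^{n+1}_{pfa}(X)=q_2.$$
   Context: ''Arbitrary discrete space'' $(X,\Sigma_d)$: $X$ is an infinite set, $\Sigma_d=2^X$ is the sigma-algebra of all subsets of $X$, and the cardinality of $X$ is ''immeasurable'', meaning that every finite countably additive measure on $2^X$ that is zero on every one-point set is identically zero. $B(X,\Sigma_d)$ is the space of bounded $\Sigma_d$-measurable functions $X\to\mathbb R$. $ba(X,\Sigma_d)$ and $ca(X,\Sigma_d)$ are the spaces of bounded real-valued finitely additive, respectively countably additive, measures on $\Sigma_d$, with the total variation norm. A finitely additive measure $\mu\ge0$ is purely finitely additive if every countably additive measure $\lambda$ with $0\le\lambda\le\mu$ is identically zero; a signed measure is purely finitely additive if both components of its Jordan decomposition are. $pfa(X,\Sigma_d)$ is the space of bounded purely finitely additive measures. Every $\mu\in ba(X,\Sigma_d)$ decomposes uniquely as $\mu=\mu_{ca}+\mu_{pfa}$ with $\mu_{ca}\in ca$, $\mu_{pfa}\in pfa$; $\mu^n_{ca}$ and $\mu^n_{pfa}$ denote the components $(\mu^n)_{ca}$ and $(\mu^n)_{pfa}$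 of the measure $\mu^n$. For $\ast\in\{ba,ca,pfa\}$, $V_\ast$ is the set of nonnegative $\mu\in\ast(X,\Sigma_d)$ with $\mu(X)\le1$; $S_{ba}=\{\mu\in V_{ba}:\mu(X)=1\}$. A finitely additive Markov chain is given by a finitely additive Markov kernel: a function $P(x,E)$, $x\in X$, $E\in\Sigma_d$, with $0\le P(x,E)\le1$, $P(\cdot,E)\in B(X,\Sigma_d)$ for all $E$, $P(x,\cdot)\in ba(X,\Sigma_d)$ and $P(x,X)=1$ for all $x$. It decomposes uniquely as $P(x,E)=P_{ca}(x,E)+P_{pfa}(x,E)$ with $P_{ca}(x,\cdot)\in ca(X,\Sigma_d)$, $P_{pfa}(x,\cdot)\in pfa(X,\Sigma_d)$ for all $x$. The operators on $ba(X,\Sigma_d)$ are $A\mu(E)=\int_X P(x,E)\,\mu(dx)$, $A_{ca}\mu(E)=\int_X P_{ca}(x,E)\,\mu(dx)$, $A_{pfa}\mu(E)=\int_X P_{pfa}(x,E)\,\mu(dx)$ (Radon integrals: the sup-norm continuous extension of the integral of simple functions), so $A=A_{ca}+A_{pfa}$. The chain is called combined if there are constants $0\le q_1,q_2\le1$, $q_1+q_2=1$, with $P_{ca}(x,X)=q_1$ and $P_{pfa}(x,X)=q_2$ for all $x\in X$; it is called non-degenerate if $0<q_1,q_2<1$. $\mathbb N=\{1,2,3,\dots\}$. *)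

(* Defs.v *)
From HB Require Import structures.
From mathcomp Require Import all_boot all_order all_algebra.
From mathcomp Require Import all_classical all_reals all_analysis.

Set Implicit Arguments.
Unset Strict Implicit.
Unset Printing Implicit Defensive.

Import Order.TTheory GRing.Theory Num.Theory.
Import numFieldNormedType.Exports.

Local Open Scope classical_set_scope.
Local Open Scope ring_scope.

(* Set functions are real-valued and total on [set X]; only their values on
   measurable sets are meaningful.  [EFin \o mu] is used to reach the library's
   additivity predicates, which are stated for extended-real set functions. *)

Section finitely_additive_measures.
Context d (X : measurableType d) (R : realType).
Implicit Types (mu nu : set X -> R) (f : X -> R) (K : set (set X -> R)).

Definition B_space : set (X -> R) :=
  [set f : X -> R | measurable_fun [set: X] f /\ exists M : R, forall x, `|f x| <= M].

Definition ba : set (set X -> R) :=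
  [set mu | measure_function.additive (EFin \o mu) /\
            exists M : R, forall E, measurable E -> `|mu E| <= M].

Definition ca : set (set X -> R) :=
  [set mu | ba mu /\ sigma_additive (EFin \o mu)].

Definition nonneg mu := forall E, measurable E -> 0 <= mu E.

(* Jordan decomposition of a finitely additive measure (no Hahn decomposition
   is available): mu^+(E) = sup_(F <= E) mu F and mu^- = (- mu)^+. *)
Definition ba_pos mu : set X -> R :=
  fun E => sup [set mu F | F in [set F | measurable F /\ F `<=` E]].

Definition ba_neg mu : set X -> R := ba_pos (\- mu).

Definition purely_finitely_additive mu :=
  forall nu, ca nu -> (forall E, measurable E -> 0 <= nu E <= mu E) ->
  forall E, measurable E -> nu E = 0.

Definition pfa : set (set X -> R) :=
  [set mu | [/\ ba mu, purely_finitely_additive (ba_pos mu) &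
                purely_finitely_additive (ba_neg mu)]].

Definition V_ K : set (set X -> R) :=
  [set mu | [/\ K mu, nonneg mu & mu [set: X] <= 1]].

Definition S_ba : set (set X -> R) := [set mu | V_ ba mu /\ mu [set: X] = 1].

(* Total variation norm: supremum over finite disjoint measurable families. *)
Definition tv_norm mu : R :=
  sup [set r | exists n (F : (set X)^nat),
    [/\ forall i, measurable (F i), trivIset [set: nat] F &
        r = \sum_(i < n) `|mu (F i)|]].

Definition ca_pfa_decomposition mu (p : (set X -> R) * (set X -> R)) :=
  [/\ ca p.1, pfa p.2 & forall E, measurable E -> mu E = p.1 E + p.2 E].

Definition ca_pfa_parts mu : (set X -> R) * (set X -> R) :=
  xget (fun=> 0, fun=> 0) (ca_pfa_decomposition mu).

Definition ca_part mu : set X -> R := (ca_pfa_parts mu).1.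

Definition pfa_part mu : set X -> R := (ca_pfa_parts mu).2.

Definition simple_functions : set (X -> R) :=
  [set g : X -> R | measurable_fun [set: X] g /\ finite_set (range g)].

(* The continuous extension to f of the integral of simple functions: the limit
   of that integral as simple functions g tend to f uniformly on X. *)
Definition radon_integral mu f : R :=
  lim ((fine (sintegral (EFin \o mu) g))
       @[g --> within simple_functions (nbhs (f : {uniform X -> R}))]).

Definition kernel_operator (P : X -> set X -> R) mu : set X -> R :=
  fun E => radon_integral mu (P ^~ E).

End finitely_additive_measures.

Section markov_chains.
Context d (X : measurableType d) (R : realType).
Implicit Types P : X -> set X -> R.

Record finitely_additive_markov_kernel P : Prop := {
  kernel_ge0_le1 : forall x E, measurable E -> 0 <= P x E <= 1;
  kernel_B : forall E, measurable E -> B_space (P ^~ E);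
  kernel_ba : forall x, ba (P x);
  kernel_setT : forall x, P x [set: X] = 1 }.

Definition kernel_ca P : X -> set X -> R := fun x => ca_part (P x).

Definition kernel_pfa P : X -> set X -> R := fun x => pfa_part (P x).

Definition combined P (q1 q2 : R) :=
  [/\ 0 <= q1 <= 1, 0 <= q2 <= 1, q1 + q2 = 1,
      forall x, kernel_ca P x [set: X] = q1 &
      forall x, kernel_pfa P x [set: X] = q2].

Definition non_degenerate (q1 q2 : R) := 0 < q1 < 1 /\ 0 < q2 < 1.

End markov_chains.

(* In a discrete space this says that the cardinality of X is immeasurable.
   Nonnegative measures suffice: if a signed one vanishes on points, so do both
   components of its Jordan decomposition. *)
Definition immeasurable d (X : measurableType d) (R : realType) :=
  forall mu : {finite_measure set X -> \bar R},
    (forall x, mu [set x] = 0%E) -> forall E, measurable E -> mu E = 0%E.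

(* Every infinite set is inhabited, so the base point that [measurableType]
   carries is harmless. *)
Record arbitrary_discrete_space d (X : measurableType d) (R : realType) : Prop := {
  space_infinite : infinite_set [set: X];
  space_discrete : @measurable d X = discrete_measurable;
  space_immeasurable : immeasurable X R }.

(* Main.v *)
Require Import Defs.
From HB Require Import structures.
From mathcomp Require Import all_boot all_order all_algebra.
From mathcomp Require Import all_classical all_reals all_analysis.
From mathcomp Require Import lra.

(** On a discrete space of immeasurable cardinality a countably additive measure
    is determined by its values on points: the Hahn decomposition reduces a
    signed measure to positive ones, and a finite positive measure vanishing on
    points is zero ([ca_points0]).  Two consequences follow.

    First, the decomposition of a nonnegative finitely additive [mu] into a
    countably additive and a purely finitely additive part is explicit and
    unique ([decomposition_unique], [ca_pfa_partsE]).  The countably additive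
    part is the atomic part [E |-> sup {mu F | F finite, F <= E}], and the rest
    vanishes on points.  Conversely, whatever is nonnegative and vanishes on
    points is purely finitely additive ([diffuse_pfa]).

    Secondly, countable additivity can be checked by tightness: a nonnegative
    finitely additive measure for which finite sets carry all but an arbitrarily
    small part of the mass is countably additive ([tight_ca]), and atomic parts
    are tight ([atomic_part_tight]).

    Let now [m] be a finitely additive probability, and write [A_ca] and [A_pfa]
    for the operators of the atomic and diffuse parts of the kernel.  The measure
    [A_pfa m] vanishes on points, since the value at a point is the integral of
    the zero function; so it is purely finitely additive.  The measure [A_ca m]
    is the sum of [A_ca] applied to the atomic and to the diffuse part of [m]:
    the former is tight because the kernel and the measure both are
    ([kernel_operator_tight]), the latter is countably additive by the hypothesis
    on [A_ca].  Hence [(A_ca m, A_pfa m)] is the decomposition of [A m], and its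
    total masses are the integrals of the constants [q1] and [q2] against a
    probability.

    All integrals are handled through one estimate, [radon_integral_approx]: the
    integral of a simple function uniformly [e]-close to [f] is within
    [e * mu X] of the integral of [f].  Linearity, monotonicity and additivity in
    the measure are proved on simple functions and transferred by it. *)

Set Implicit Arguments.
Unset Strict Implicit.
Unset Printing Implicit Defensive.

Import Order.TTheory GRing.Theory Num.Theory.
Import numFieldNormedType.Exports.

Local Open Scope classical_set_scope.
Local Open Scope ring_scope.

(** * Finitely additive set functions *)

Section finitely_additive.
Context {T : Type} {R : realType}.
Implicit Types (mu : set T -> R) (A B E : set T).

Definition fin_additive mu :=
  mu set0 = 0 /\ forall A B, A `&` B = set0 -> mu (A `|` B) = mu A + mu B.

Definition fa_measure mu := fin_additive mu /\ forall E, 0 <= mu E.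

Lemma fin_additiveD mu A B : fin_additive mu -> A `<=` B ->
  mu B = mu A + mu (B `\` A).
Proof.
move=> [_ muU] AB; rewrite -muU ?setDIK//.
by rewrite setDUK.
Qed.

Lemma fa_measure_le mu A B : fa_measure mu -> A `<=` B -> mu A <= mu B.
Proof. by move=> [mu_add mu_ge0] AB; rewrite (fin_additiveD mu_add AB) lerDl. Qed.

Lemma fin_additive_fibers mu (I : eqType) (phi : T -> I) (s : seq I) E :
  fin_additive mu -> uniq s -> (forall x, E x -> phi x \in s) ->
  mu E = \sum_(i <- s) mu (E `&` phi @^-1` [set i]).
Proof.
move=> mu_add; elim: s E => [|i s IH] E /=.
  move=> _ Es; rewrite big_nil; suff -> : E = set0 by have [] := mu_add.
  by rewrite -subset0 => x /Es.
move=> /andP[iNs us] Es; rewrite big_cons.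
rewrite (fin_additiveD mu_add (@subIsetl _ E (phi @^-1` [set i]))).
congr (_ + _); rewrite (IH _ us).
  apply: eq_big_seq => j js; congr (mu _); apply/seteqP; split => x /=.
    by move=> [[Ex _] pj].
  move=> [Ex pj]; do !split => //; case=> _ pi.
  by move: iNs; rewrite -pi pj js.
move=> x [Ex Nx]; have := Es _ Ex; rewrite inE => /orP[/eqP pi|//].
by exfalso; apply: Nx.
Qed.

Lemma fa_measure_norm_le1 mu E : fa_measure mu -> mu setT <= 1 -> `|mu E| <= 1.
Proof.
move=> muC mu1; rewrite ger0_norm; last exact: (proj2 muC).
by apply: le_trans mu1; exact: fa_measure_le.
Qed.

Lemma fin_additive_bigsetU mu (F : (set T)^nat) n :
  fin_additive mu -> trivIset setT F ->
  mu (\big[setU/set0]_(i < n) F i) = \sum_(i < n) mu (F i).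
Proof.
move=> [mu0 muU] tF; elim: n => [|n IH]; first by rewrite !big_ord0.
rewrite !big_ord_recr/= muU ?IH//; apply/seteqP; split => // x [].
rewrite -bigcup_mkord => -[k /= kn Fk] Fn.
have /= := tF k n I I; move=> /(_ (ex_intro _ x (conj Fk Fn))) kn'.
by move: kn; rewrite kn' ltnn.
Qed.

End finitely_additive.

(** * The Radon integral of bounded functions *)

Section radon.
Context d (X : measurableType d) (R : realType).
Context (measurable_all : forall E : set X, measurable E).
Implicit Types (mu : set X -> R) (f g h : X -> R).

Definition simple_integral mu g : R := fine (sintegral (EFin \o mu) g).

Lemma simple_integral_seq mu g (s : seq R) : fin_additive mu -> uniq s ->
  (forall x, g x \in s) ->
  simple_integral mu g = \sum_(r <- s) r * mu (g @^-1` [set r]).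
Proof.
move=> [mu0 _] us gs; rewrite /simple_integral /sintegral (fsbigE s)//.
  rewrite (eq_bigl xpredT); last by move=> i; rewrite in_setT.
  by under eq_bigr do rewrite /= -EFinM; rewrite sumEFin.
move=> r _ rs; suff -> : g @^-1` [set r] = set0 by rewrite /= mu0 mule0.
by rewrite -subset0 => x /= gx; have := gs x; rewrite gx (negbTE rs).
Qed.

(** The change-of-variables form of the integral: a simple function may be
    presented through any finite-valued map it factors through.  With the pair
    [(g, h)] as that map, two simple functions share one partition, which reduces
    additivity and monotonicity to termwise statements. *)
Lemma simple_integral_comp mu (I : eqType) (phi : X -> I) (s : seq I)
    (k : I -> R) : fin_additive mu -> uniq s -> (forall x, phi x \in s) ->
  simple_integral mu (k \o phi) = \sum_(i <- s) k i * mu (phi @^-1` [set i]).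
Proof.
move=> mu_add us ps; pose u := undup (map k s).
rewrite (@simple_integral_seq _ _ u) ?undup_uniq//; last first.
  by move=> x; rewrite mem_undup; exact: map_f.
under eq_bigr do rewrite (@fin_additive_fibers _ _ _ _ phi s _ mu_add us)//
  mulr_sumr.
rewrite exchange_big/=; apply: eq_big_seq => i si.
have ku : k i \in u by rewrite mem_undup map_f.
rewrite (bigD1_seq (k i)) ?undup_uniq//= big1 ?addr0.
  congr (_ * mu _); apply/seteqP; split => [x []//|x /= ->//].
move=> r rk; rewrite [X in mu X](_ : _ = set0) ?(proj1 mu_add) ?mulr0//.
by rewrite -subset0 => x [/= kr pxi]; move: rk; rewrite -kr pxi eqxx.
Qed.

Lemma simple_range g : simple_functions g ->
  exists2 s : seq R, uniq s & forall x, g x \in s.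
Proof.
move=> [_ /finite_seqP[s gs]]; exists (undup s); first exact: undup_uniq.
move=> x; have : range g (g x) by exists x.
by rewrite gs mem_undup.
Qed.

Lemma simple_functionsP (I : eqType) (phi : X -> I) (s : seq I) (k : I -> R) :
  (forall x, phi x \in s) -> simple_functions (k \o phi).
Proof.
move=> ps; split; first by move=> _ Y _; exact: measurable_all.
apply: (@sub_finite_set _ _ [set` map k s]); last exact: finite_seq.
by move=> _ [x _ <-] /=; exact: map_f.
Qed.

Lemma simple_pair g h : simple_functions g -> simple_functions h ->
  exists2 s : seq (R * R), uniq s & forall x, (g x, h x) \in s.
Proof.
move=> /simple_range[s us gs] /simple_range[t ut ht].
exists [seq (a, b) | a <- s, b <- t]; first by apply: allpairs_uniq => // -[? ?] [? ?].
by move=> x; apply: allpairs_f.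
Qed.

Lemma simple_cst (c : R) : simple_functions (fun _ : X => c).
Proof. exact: (@simple_functionsP _ (fun=> tt) [:: tt] (fun=> c)). Qed.

Lemma simpleD g h : simple_functions g -> simple_functions h ->
  simple_functions (g \+ h).
Proof.
move=> sg sh; have [s _ ghs] := simple_pair sg sh.
exact: (@simple_functionsP _ _ s (fun p => p.1 + p.2) ghs).
Qed.

Section fixed_fa_measure.
Context mu (mu_fa_measure : fa_measure mu).

Let mu_add : fin_additive mu := proj1 mu_fa_measure.

Lemma simple_integral_cst (c : R) : simple_integral mu (fun=> c) = c * mu setT.
Proof.
have := @simple_integral_comp mu _ (fun=> tt) [:: tt] (fun=> c) mu_add.
rewrite big_seq1 => ->//; congr (_ * mu _).
by apply/seteqP; split => x //=.
Qed.

Lemma simple_integralD g h : simple_functions g -> simple_functions h ->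
  simple_integral mu (g \+ h) = simple_integral mu g + simple_integral mu h.
Proof.
move=> sg sh; have [s us ghs] := simple_pair sg sh.
pose phi x := (g x, h x).
rewrite (@simple_integral_comp _ _ phi s (fun p => p.1 + p.2))//.
rewrite (@simple_integral_comp _ _ phi s fst)//.
rewrite (@simple_integral_comp _ _ phi s snd)//.
by rewrite -big_split/=; apply: eq_bigr => p _; rewrite mulrDl.
Qed.

Lemma simple_integral_le g h : simple_functions g -> simple_functions h ->
  (forall x, g x <= h x) -> simple_integral mu g <= simple_integral mu h.
Proof.
move=> sg sh gh; have [s us ghs] := simple_pair sg sh.
pose phi x := (g x, h x).
rewrite (@simple_integral_comp _ _ phi s fst)//.
rewrite (@simple_integral_comp _ _ phi s snd)//.
apply: ler_sum => -[a b] _ /=.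
have [->|/set0P[x [/= <- <-]]] := eqVneq (phi @^-1` [set (a, b)]) set0.
  by rewrite (proj1 mu_add) !mulr0.
by rewrite ler_wpM2r//; apply: (proj2 mu_fa_measure).
Qed.

Lemma simple_integral_le_add (e : R) g h :
  simple_functions g -> simple_functions h ->
  (forall x, g x <= h x + e) ->
  simple_integral mu g <= simple_integral mu h + e * mu setT.
Proof.
move=> sg sh gh; rewrite -simple_integral_cst.
have sc := simple_cst e.
rewrite -(simple_integralD sh sc); apply: simple_integral_le => //.
exact: simpleD.
Qed.

End fixed_fa_measure.

(** Rounding [f] down to the grid of mesh [e] based at [- M]. *)
Lemma simple_approx f (M e : R) : 0 < e -> (forall x, `|f x| <= M) ->
  exists2 g, simple_functions g & forall x, `|f x - g x| <= e.
Proof.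
move=> e0 fM; pose phi x := Num.truncn ((f x + M) / e).
pose k (m : nat) := e * m%:R - M.
have fM0 x : 0 <= f x + M by have := fM x; rewrite ler_norml; lra.
exists (k \o phi).
  apply: (@simple_functionsP _ phi (iota 0 (Num.truncn ((M + M) / e)).+1)) => x.
  rewrite mem_iota leq0n add0n ltnS; apply: Num.Theory.le_truncn.
  by rewrite ler_pM2r ?invr_gt0//; have := fM x; rewrite ler_norml; lra.
move=> x /=; rewrite /k.
have := @Num.Theory.truncn_itv R _ (divr_ge0 (fM0 x) (ltW e0)).
rewrite -/(phi x) -natr1 ler_pdivlMr// ltr_pdivrMr// ler_norml mulrDl mul1r.
by rewrite (mulrC e); lra.
Qed.

Lemma nbhs_uniform_simple f (e : R) : 0 < e ->
  \forall g \near within (@simple_functions _ X R) (nbhs (f : {uniform X -> R})),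
    simple_functions g /\ forall x, `|f x - g x| <= e.
Proof.
move=> e0; rewrite near_withinE; apply/uniform_nbhs.
exists [set xy | ball xy.1 e xy.2]; split; first exact: (entourage_ball _ (PosNum e0)).
by move=> g /= fg sg; split=> // x; apply: ltW; have := fg x I.
Qed.

(** Properness of the filter, by density of simple functions, is what makes
    the limit defining the integral meaningful. *)
Lemma radon_integral_proper f (M : R) : (forall x, `|f x| <= M) ->
  ProperFilter (within (@simple_functions _ X R) (nbhs (f : {uniform X -> R}))).
Proof.
move=> fM; split; last by apply: within_filter; exact: nbhs_filter.
rewrite /within/= => /uniform_nbhs[E [entE sE]].
move: entE; rewrite -entourage_ballE => -[e /= e0 Ee].
have e20 : 0 < e / 2 by rewrite divr_gt0.
have [g sg gf] := simple_approx e20 fM.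
apply: (sE g) => // y _; apply: Ee => /=; rewrite /ball/=.
by rewrite (le_lt_trans (gf y))// ltr_pdivrMr// ltr_pMr// ltr1n.
Qed.

(** The limit is identified with the lower integral [sup S], which obeys the
    estimate because shifting [g] by [e] up or down sandwiches [f] between
    simple functions. *)
Lemma radon_integral_approx mu f (M e : R) g : fa_measure mu ->
  (forall x, `|f x| <= M) -> simple_functions g ->
  (forall x, `|f x - g x| <= e) ->
  `|simple_integral mu g - radon_integral mu f| <= e * mu setT.
Proof.
move=> muC fM sg gf.
pose S := [set r | exists h, [/\ simple_functions h, forall x, h x <= f x &
                              r = simple_integral mu h]].
have key h e' : simple_functions h -> (forall x, `|f x - h x| <= e') ->
    `|simple_integral mu h - sup S| <= e' * mu setT.
  move=> sh hf.
  have mu_h r : S r -> r <= simple_integral mu h + e' * mu setT.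
    move=> [k [sk kf ->]]; apply: simple_integral_le_add => // x.
    by have := hf x; have := kf x; rewrite ler_norml; lra.
  have ubS : has_ubound S by exists (simple_integral mu h + e' * mu setT).
  have Sh : S (simple_integral mu h + (- e') * mu setT).
    exists (h \+ (fun=> - e')); split.
    - by apply: simpleD => //; exact: simple_cst.
    - by move=> x /=; have := hf x; rewrite ler_norml; lra.
    - rewrite simple_integralD//; last exact: simple_cst.
      by rewrite simple_integral_cst.
  have h1 := ub_le_sup ubS Sh.
  have h2 : sup S <= simple_integral mu h + e' * mu setT.
    by apply: ge_sup => //; exists (simple_integral mu h + (- e') * mu setT).
  by rewrite ler_norml; move: h1 h2; rewrite mulNr; lra.
suff -> : radon_integral mu f = sup S by exact: key.
rewrite /radon_integral; have PF := radon_integral_proper fM.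
apply: cvg_lim; first exact: Rhausdorff.
apply/cvgrPdist_le => e1 e10.
have muT1 : 0 < mu setT + 1 by have := proj2 muC setT; lra.
have e20 : 0 < e1 / (mu setT + 1) by rewrite divr_gt0.
apply: filterS (nbhs_uniform_simple f e20) => h [sh hf].
rewrite distrC (le_trans (key _ _ sh hf))// mulrAC ler_pdivrMr//.
by rewrite ler_pM2l// lerDl.
Qed.

Section radon_theory.
Context mu (mu_fa_measure : fa_measure mu).

(** The converse use of the estimate: to compute an integral it suffices to
    guess its value up to [C * e] along some [e]-approximations. *)
Lemma radon_integral_unique f (M C r : R) : (forall x, `|f x| <= M) ->
  (forall e, 0 < e -> exists g, [/\ simple_functions g,
     forall x, `|f x - g x| <= e & `|simple_integral mu g - r| <= C * e]) ->
  radon_integral mu f = r.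
Proof.
move=> fM fr; apply/eqP; rewrite -subr_eq0 -normr_le0; apply/ler_addgt0Pl => e e0.
rewrite addr0.
have muT0 : 0 <= mu setT by exact: (proj2 mu_fa_measure).
have K0 : 0 < mu setT + `|C| + 1 by have := normr_ge0 C; lra.
have [g [sg fg gr]] := fr _ (divr_gt0 e0 K0).
have := radon_integral_approx mu_fa_measure fM sg fg.
move: gr; set t := e / _ => gr gR.
have <- : (mu setT + `|C| + 1) * t = e by rewrite mulrC divfK// gt_eqF.
have t0 : 0 < t by rewrite divr_gt0.
rewrite -[X in `|X|](subrKA (simple_integral mu g)).
rewrite (le_trans (ler_normD _ _))// distrC.
have Ct : C * t <= `|C| * t by rewrite ler_pM2r// ler_norm.
rewrite (le_trans (lerD gR gr))// !mulrDl mul1r (mulrC t); lra.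
Qed.

Lemma radon_integral_simple g : simple_functions g ->
  radon_integral mu g = simple_integral mu g.
Proof.
move=> sg; have [s us gs] := simple_range sg.
apply: (@radon_integral_unique _ (\sum_(r <- s) `|r|) 0).
  by move=> x; rewrite (bigD1_seq (g x))//= lerDl; apply: sumr_ge0.
move=> e e0; exists g; split => //.
  by move=> x; rewrite subrr normr0 ltW.
by rewrite subrr normr0 mul0r.
Qed.

Lemma radon_integral_cst (c : R) : radon_integral mu (fun=> c) = c * mu setT.
Proof.
rewrite radon_integral_simple ?simple_integral_cst//; exact: simple_cst.
Qed.

Lemma radon_integralD f h (M N : R) :
  (forall x, `|f x| <= M) -> (forall x, `|h x| <= N) ->
  radon_integral mu (f \+ h) = radon_integral mu f + radon_integral mu h.
Proof.
move=> fM hN; apply: (@radon_integral_unique _ (M + N) (mu setT)).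
  by move=> x; rewrite (le_trans (ler_normD _ _))// lerD.
move=> e e0; have e20 : 0 < e / 2 by rewrite divr_gt0.
have [g sg fg] := simple_approx e20 fM.
have [k sk hk] := simple_approx e20 hN.
exists (g \+ k); split; first exact: simpleD.
- move=> x /=; rewrite opprD addrACA (le_trans (ler_normD _ _))//.
  by rewrite [leRHS]splitr lerD.
- rewrite simple_integralD// opprD addrACA (le_trans (ler_normD _ _))//.
  rewrite mulrC [e in leRHS]splitr mulrDl; apply: lerD.
    exact: radon_integral_approx fg.
  exact: radon_integral_approx hk.
Qed.

Lemma radon_integral_ge0 f (M : R) : (forall x, `|f x| <= M) ->
  (forall x, 0 <= f x) -> 0 <= radon_integral mu f.
Proof.
move=> fM f0; apply/ler_addgt0Pl => e e0.
have muT1 : 0 < mu setT + 1 by have := proj2 mu_fa_measure setT; lra.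
have t0 : 0 < e / (2 * (mu setT + 1)) by rewrite divr_gt0// mulr_gt0.
have [g sg fg] := simple_approx t0 fM.
have := radon_integral_approx mu_fa_measure fM sg fg.
have := @simple_integral_le_add _ mu_fa_measure (e / (2 * (mu setT + 1))) (fun=> 0) g
  (simple_cst 0) sg.
rewrite simple_integral_cst// mul0r.
have gh x : 0 <= g x + e / (2 * (mu setT + 1)).
  by have := fg x; have := f0 x; rewrite ler_norml; lra.
move=> /(_ gh).
have : e / (2 * (mu setT + 1)) * mu setT <= e / 2.
  rewrite mulrAC ler_pdivrMr ?mulr_gt0// mulrA divfK ?pnatr_eq0//.
  by rewrite ler_pM2l// lerDl.
rewrite ler_norml; lra.
Qed.

Lemma radon_integral_le f h (M N : R) :
  (forall x, `|f x| <= M) -> (forall x, `|h x| <= N) ->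
  (forall x, f x <= h x) -> radon_integral mu f <= radon_integral mu h.
Proof.
move=> fM hN fh.
have hfMN x : `|h x - f x| <= N + M.
  by rewrite (le_trans (ler_normB _ _))// lerD.
have -> : h = f \+ (fun x => h x - f x) by apply/funext => x /=; rewrite addrC subrK.
by rewrite (radon_integralD fM hfMN) lerDl (radon_integral_ge0 hfMN)// => x; rewrite subr_ge0.
Qed.

Lemma radon_integral_indic (A : set X) :
  radon_integral mu (\1_A : X -> R) = mu A.
Proof.
have iE : (\1_A : X -> R) = (fun b : bool => b%:R) \o (fun x => x \in A).
  by apply/funext => x /=; rewrite indicE.
have s2 : forall x, (x \in A) \in [:: true; false] by move=> x; case: (x \in A).
rewrite radon_integral_simple; last by rewrite iE; exact: simple_functionsP s2.
rewrite iE (@simple_integral_comp _ _ _ _ _ (proj1 mu_fa_measure) _ s2)//.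
rewrite big_cons big_seq1/= mul1r mul0r addr0; congr (mu _).
by apply/seteqP; split => x /= => [/set_mem|/mem_set].
Qed.

End radon_theory.

Lemma fa_measure_add mu nu : fa_measure mu -> fa_measure nu -> fa_measure (mu \+ nu).
Proof.
move=> [[m0 mU] m_ge0] [[n0 nU] n_ge0]; split; first split => /=.
- by rewrite m0 n0 addr0.
- by move=> A B AB; rewrite mU// nU// addrACA.
- by move=> E /=; rewrite addr_ge0.
Qed.

Lemma radon_integral_addmeasure mu nu f (M : R) : fa_measure mu -> fa_measure nu ->
  (forall x, `|f x| <= M) ->
  radon_integral (mu \+ nu) f = radon_integral mu f + radon_integral nu f.
Proof.
move=> muC nuC fM.
have mnC := fa_measure_add muC nuC.
apply: (@radon_integral_unique _ mnC _ M (mu setT + nu setT)) => // e e0.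
have [g sg fg] := simple_approx e0 fM; exists g; split => //.
have [s us gs] := simple_range sg.
have -> : simple_integral (mu \+ nu) g = simple_integral mu g + simple_integral nu g.
  rewrite (simple_integral_seq (proj1 mnC) us gs).
  rewrite (simple_integral_seq (proj1 muC) us gs).
  rewrite (simple_integral_seq (proj1 nuC) us gs).
  by rewrite -big_split; apply: eq_bigr => r _ /=; rewrite mulrDr.
rewrite opprD addrACA (le_trans (ler_normD _ _))// mulrDl lerD// mulrC;
  exact: radon_integral_approx fg.
Qed.

Lemma kernel_operator_fa_measure (K : X -> set X -> R) mu : fa_measure mu ->
  (forall x, fa_measure (K x)) -> (forall x, K x setT <= 1) ->
  fa_measure (kernel_operator K mu).
Proof.
move=> muC KC K1.
have Kb x E : `|K x E| <= 1.
  exact: fa_measure_norm_le1.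
rewrite /kernel_operator; split; first split.
- rewrite (_ : K ^~ set0 = fun=> 0) ?radon_integral_cst ?mul0r//.
  by apply/funext => x; exact: (proj1 (proj1 (KC x))).
- move=> A B AB; rewrite -(radon_integralD muC (Kb^~ A) (Kb^~ B)).
  congr radon_integral; apply/funext => x /=.
  exact: (proj2 (proj1 (KC x))).
- move=> E; apply: (radon_integral_ge0 muC (Kb^~ E)) => x; exact: (proj2 (KC x)).
Qed.

End radon.

(** * Atomic and diffuse parts *)

Section atomic_part.
Context {T : Type} {R : realType}.
Implicit Types (mu : set T -> R) (A B E F : set T).

Definition atomic_part mu : set T -> R :=
  fun E => sup [set mu F | F in [set F | finite_set F /\ F `<=` E]].

Definition diffuse_part mu : set T -> R := fun E => mu E - atomic_part mu E.

Definition tight mu :=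
  forall e, 0 < e -> exists2 F, finite_set F & mu (~` F) <= e.

Context mu (mu_fa_measure : fa_measure mu).

Lemma atomic_part_ge F E : finite_set F -> F `<=` E -> mu F <= atomic_part mu E.
Proof.
move=> fF FE; apply: ub_le_sup; last by exists F.
by exists (mu E) => _ [G [_ GE] <-]; exact: fa_measure_le.
Qed.

Lemma atomic_part_le_ub E r :
  (forall F, finite_set F -> F `<=` E -> mu F <= r) -> atomic_part mu E <= r.
Proof.
move=> Er; apply: ge_sup => [|_ [F [fF FE] <-]]; last exact: Er.
by exists (mu set0), set0; split => //; exact: finite_set0.
Qed.

Lemma atomic_part_le E : atomic_part mu E <= mu E.
Proof. by apply: atomic_part_le_ub => F _; exact: fa_measure_le. Qed.

Lemma atomic_part_finite F : finite_set F -> atomic_part mu F = mu F.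
Proof.
by move=> fF; apply/eqP; rewrite eq_le atomic_part_le/= atomic_part_ge.
Qed.

(** Additivity holds since a finite subset of a disjoint union splits into finite
    subsets of the two pieces, and finite subsets of the pieces can be joined. *)
Lemma atomic_part_fa_measure : fa_measure (atomic_part mu).
Proof.
have [[mu0 muU] mu_ge0] := mu_fa_measure.
split; first split.
- by rewrite atomic_part_finite//; exact: finite_set0.
- move=> A B AB; apply/eqP; rewrite eq_le; apply/andP; split.
    apply: atomic_part_le_ub => F fF FAB.
    rewrite (fin_additiveD (proj1 mu_fa_measure) (@subIsetl _ F A)); apply: lerD.
      by apply: atomic_part_ge => //; exact: finite_setIl.
    apply: atomic_part_ge; first exact: finite_setD.
    move=> x [Fx FAx]; have [Ax|//] := FAB _ Fx.
    by exfalso; apply: FAx.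
  rewrite -lerBrDr; apply: atomic_part_le_ub => F fF FA.
  rewrite lerBrDr -lerBrDl; apply: atomic_part_le_ub => G fG GB.
  rewrite lerBrDl -muU.
    by apply: atomic_part_ge; [rewrite finite_setU|exact: setUSS].
  by rewrite -subset0 -AB; exact: setISS.
- by move=> E; rewrite (le_trans (mu_ge0 set0))// atomic_part_ge//; exact: finite_set0.
Qed.

(** By definition of the supremum, some finite set carries almost all of the
    total atomic mass. *)
Lemma atomic_part_tight : tight (atomic_part mu).
Proof.
move=> e e0; pose S := [set mu F | F in [set F | finite_set F /\ F `<=` setT]].
have hS : has_sup S.
  split; first by exists (mu set0), set0; split => //; exact: finite_set0.
  by exists (mu setT) => _ [G [_ GE] <-]; exact: fa_measure_le.
have [_ [F [fF _] <-] Fe] := sup_adherent e0 hS.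
exists F => //.
have := fin_additiveD (proj1 atomic_part_fa_measure) (@subsetT _ F).
have -> : atomic_part mu setT = sup S by [].
by rewrite setTD atomic_part_finite//; lra.
Qed.

Lemma diffuse_part_fa_measure : fa_measure (diffuse_part mu).
Proof.
have [[mu0 muU] _] := mu_fa_measure.
have [[a0 aU] _] := atomic_part_fa_measure.
rewrite /diffuse_part; split; first split.
- by rewrite mu0 a0 subrr.
- by move=> A B AB; rewrite muU// aU// opprD addrACA.
- by move=> E; rewrite subr_ge0 atomic_part_le.
Qed.

Lemma diffuse_part_set1 x : diffuse_part mu [set x] = 0.
Proof. by rewrite /diffuse_part atomic_part_finite ?subrr//; exact: finite_set1. Qed.

Lemma atomic_diffuseE : mu = atomic_part mu \+ diffuse_part mu.
Proof. by apply/funext => E /=; rewrite /diffuse_part addrC subrK. Qed.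

End atomic_part.

(** * Countable additivity on a discrete space *)

Section discrete.
Context d (X : measurableType d) (R : realType).
Context (measurable_all : forall E : set X, measurable E).
Implicit Types (mu nu : set X -> R) (E F : set X).

#[local] Hint Resolve measurable_all : core.

Lemma trivIset_cst_set0 : trivIset [set: nat] (fun=> set0 : set X).
Proof. by move=> i j _ _ [x []]. Qed.

Lemma ba_fin_additive mu : ba mu -> fin_additive mu.
Proof.
move=> [mu_add _]; split.
  have := mu_add (fun=> set0) (fun=> measurable0) trivIset_cst_set0 0%N.
  by rewrite !big_ord0/= => -[].
move=> A B AB; have := mu_add (bigcup2 A B) (fun=> measurable_all _) _ 2%N.
rewrite !big_ord_recr !big_ord0/= set0U add0e -EFinD => H.
by move: AB; rewrite trivIset_bigcup2 => /H[].
Qed.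

Lemma fa_measure_ba mu : fa_measure mu -> ba mu.
Proof.
move=> muC; split; last first.
  exists (mu setT) => E _; rewrite ger0_norm; first exact: fa_measure_le.
  exact: (proj2 muC).
move=> F _ tF n; rewrite /= fin_additive_bigsetU ?sumEFin//.
exact: (proj1 muC).
Qed.

Lemma ba_addZ (a : R) mu nu : ba mu -> ba nu -> ba (fun E => mu E + a * nu E).
Proof.
move=> [mu_add [M muM]] [nu_add [N nuN]]; split.
  move=> F mF tF n /=.
  have := mu_add F mF tF n; have := nu_add F mF tF n.
  rewrite /= !sumEFin => -[->] [->].
  by congr EFin; rewrite mulr_sumr big_split.
exists (M + `|a| * N) => E mE; rewrite (le_trans (ler_normD _ _))// lerD ?muM//.
by rewrite normrM ler_wpM2l// nuN.
Qed.

Lemma sigma_additive_fin mu : sigma_additive (EFin \o mu) <->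
  forall F : (set X)^nat, trivIset setT F ->
  (fun n => \sum_(0 <= i < n) mu (F i)) @ \oo --> mu (\bigcup_n F n).
Proof.
split=> H F.
  move=> tF; have := H F (fun=> measurable_all _) tF.
  under eq_fun do rewrite /= sumEFin.
  by move/fine_cvgP => [].
move=> _ tF; under eq_fun do rewrite /= sumEFin.
apply: cvg_EFin; first by near=> n.
exact: H.
Unshelve. all: by end_near. Qed.

Lemma ca_addZ (a : R) mu nu : ca mu -> ca nu -> ca (fun E => mu E + a * nu E).
Proof.
move=> [mb /sigma_additive_fin ms] [nb /sigma_additive_fin ns].
split; first exact: ba_addZ.
apply/sigma_additive_fin => F tF.
under eq_fun do rewrite big_split/= -mulr_sumr.
by apply: cvgD; [exact: ms|apply: cvgMr; exact: ns].
Qed.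

(** The finite set given by tightness meets only finitely many terms of a
    disjoint sequence, so the remainder of the sequence is eventually contained
    in its complement. *)
Lemma tight_ca mu : fa_measure mu -> tight mu -> ca mu.
Proof.
move=> muC mu_tight; split; first exact: fa_measure_ba.
apply/sigma_additive_fin => F tF; apply/cvgrPdist_le => e e0.
have [G fG Ge] := mu_tight _ e0.
(* past index [N] the sequence has covered every point of [G] in the union *)
have [N GN] : exists N : nat, forall x, G x -> (\bigcup_n F n) x ->
    (\big[setU/set0]_(i < N) F i) x.
  have [s Gs] := (iffLR (finite_seqP G)) fG.
  rewrite {}Gs; elim: s => [|x s [N IH]]; first by exists 0%N.
  have [[n _ Fnx]|nFx] := pselect ((\bigcup_n F n) x); last first.
    exists N => y /=; rewrite inE => /orP[/eqP ->//|]; exact: IH.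
  exists (maxn N n.+1) => y /=; rewrite inE => /orP[/eqP -> _|ys Fy].
    by rewrite -bigcup_mkord; exists n => //=; rewrite leq_max ltnSn orbT.
  have := IH _ ys Fy; rewrite -!bigcup_mkord => -[k /= kN Fk].
  by exists k => //=; rewrite leq_max kN.
exists N => // n /= Nn; rewrite big_mkord -(fin_additive_bigsetU n (proj1 muC) tF).
have sub : \big[setU/set0]_(i < n) F i `<=` \bigcup_n F n.
  by rewrite -bigcup_mkord => x [k _ Fk]; exists k.
rewrite (fin_additiveD (proj1 muC) sub) addrC addKr ger0_norm ?(proj2 muC)//.
apply: le_trans Ge; apply: fa_measure_le => // x [Fx nFx] Gx; apply: nFx.
have := GN x Gx Fx; rewrite -!bigcup_mkord => -[k /= kN Fk].
by exists k => //=; exact: leq_trans Nn.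
Qed.

Context (hX : immeasurable X R).

(** Restricting to the two sets of a Hahn decomposition gives finite positive
    measures vanishing on points, which are zero by immeasurability. *)
Lemma ca_points0 nu : ca nu -> (forall x, nu [set x] = 0) -> forall E, nu E = 0.
Proof.
move=> [nb nsig] nu1 E.
have nu0 := proj1 (ba_fin_additive nb).
have c0 : (EFin \o nu) set0 = 0%E by rewrite /= nu0.
have cf A : measurable A -> (EFin \o nu) A \is a fin_num by [].
have cs : semi_sigma_additive (EFin \o nu) by move=> F mF tF _; exact: nsig.
pose cB := isCharge.Build _ _ _ (EFin \o nu) c0 cf cs.
pose c : {charge set X -> \bar R} := HB.pack (EFin \o nu) cB.
have [P [N PN]] := Hahn_decomposition c.
have restr_points0 (D : set X) x : c ([set x] `&` D) = 0%E.
  have [Dx|Dx] := pselect (D x).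
    by rewrite set1I mem_set//= nu1.
  by rewrite set1I memNset//= nu0.
have jp0 : jordan_pos PN E = 0%E.
  apply: hX => // x; rewrite [LHS]jordan_posE cjordan_posE /crestr0.
  by rewrite mem_set// /crestr restr_points0.
have jn0 : jordan_neg PN E = 0%E.
  apply: hX => // x; rewrite [LHS]jordan_negE cjordan_negE /crestr0.
  by rewrite mem_set// /crestr restr_points0 oppe0.
have : c E = 0%E; last by move=> /= -[].
rewrite (jordan_decomp PN (measurable_all E)) /cadd /cscale.
rewrite [X in (X + _)%E]jp0 add0e -[RHS](mule0 (-1)%:E).
exact: congr1 jn0.
Qed.

(** A countably additive measure between zero and a set function that vanishes on
    points vanishes on points too, hence is zero; and the Jordan components of
    [mu] are [mu] and [0]. *)
Lemma diffuse_pfa mu : fa_measure mu -> (forall x, mu [set x] = 0) -> pfa mu.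
Proof.
move=> muC mu1.
have pos0 (nu rho : set X -> R) : ca nu ->
    (forall E, measurable E -> 0 <= nu E <= rho E) ->
    (forall x, rho [set x] = 0) -> forall E, nu E = 0.
  move=> nuca nurho rho1; apply: ca_points0 => // x.
  by have := nurho [set x] (measurable_all _); rewrite rho1 => H; apply/eqP; rewrite eq_le andbC.
split; first exact: fa_measure_ba.
- have posE : ba_pos mu = mu.
    apply/funext => E; apply/eqP; rewrite eq_le; apply/andP; split.
      apply: ge_sup; first by exists (mu E), E; [split|].
      by move=> _ [F [_ FE] <-]; exact: fa_measure_le.
    apply: ub_le_sup; last by exists E; [split|].
    by exists (mu E) => _ [F [_ FE] <-]; exact: fa_measure_le.
  by rewrite posE => nu nuca numu E _; exact: (pos0 _ mu).
- have negE : ba_neg mu = fun=> 0.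
    apply/funext => E; apply/eqP; rewrite eq_le; apply/andP; split.
      apply: ge_sup; first by exists (- mu E), E; [split|].
      by move=> _ [F [_ FE] <-] /=; rewrite oppr_le0 (proj2 muC).
    apply: ub_le_sup; last first.
      by exists set0; [split|rewrite /= (proj1 (proj1 muC)) oppr0].
    by exists 0 => _ [F [_ FE] <-] /=; rewrite oppr_le0 (proj2 muC).
  by rewrite negE => nu nuca numu E _; exact: (pos0 _ (fun=> 0)).
Qed.

Lemma point_mass_ca (c : R) (x : X) : 0 <= c -> ca (fun E => c * \1_E x).
Proof.
move=> c0; apply: tight_ca.
  split; first split.
  - by rewrite indic0 mulr0.
  - move=> A B AB; rewrite -mulrDr !indicE in_setU; congr (_ * _).
    have [xA|] := boolP (x \in A); last by rewrite add0r.
    rewrite memNset ?addr0// => Bx.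
    by have : set0 x; [rewrite -AB; split => //; exact: set_mem|].
  - by move=> E; rewrite mulr_ge0.
move=> e e0; exists [set x]; first exact: finite_set1.
by rewrite indicE memNset ?mulr0 ?ltW//; exact.
Qed.

(** If [mu [set x]] were positive, a point mass of that size at [x] would be a
    nonzero countably additive measure below the positive part of [mu]. *)
Lemma ba_pos_pfa_set1 mu x : ba mu -> purely_finitely_additive (ba_pos mu) ->
  mu [set x] <= 0.
Proof.
move=> mb mpf; have [_ [M muM]] := mb.
have ub E : has_ubound [set mu F | F in [set F | measurable F /\ F `<=` E]].
  by exists M => _ [F [mF _] <-]; rewrite (le_trans (ler_norm _))// muM.
have pos_ge (F E : set X) : F `<=` E -> mu F <= ba_pos mu E.
  by move=> FE; apply: ub_le_sup => //; exists F; [split|].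
have mu0 := proj1 (ba_fin_additive mb).
rewrite leNgt; apply/negP => mux.
have := mpf _ (point_mass_ca x (ltW mux)) _ [set x] (measurable_all _).
rewrite indicE mem_set//= mulr1 => H.
have := mux; rewrite H ?ltxx// => E _.
rewrite indicE mulr_ge0 ?(ltW mux)//=.
have [xE|xE] := boolP (x \in E).
  by rewrite mulr1 pos_ge// => _ ->; rewrite -in_setE.
by rewrite mulr0 -mu0 pos_ge.
Qed.

Lemma pfa_set1 mu x : pfa mu -> mu [set x] = 0.
Proof.
move=> [mb mp mn]; apply/eqP; rewrite eq_le ba_pos_pfa_set1//=.
have nb : ba (\- mu).
  have [add [M muM]] := mb; split; last by exists M => E mE; rewrite normrN muM.
  move=> F mF tF n /=; have := add F mF tF n.
  by rewrite /= !sumEFin => -[->]; rewrite sumrN.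
by have := @ba_pos_pfa_set1 _ x nb mn; rewrite oppr_le0.
Qed.

(** A purely finitely additive part vanishes on points, so any countably
    additive part agrees on points with [mu], that is with the atomic part. *)
Lemma decomposition_unique mu p : fa_measure mu -> ca_pfa_decomposition mu p ->
  p = (atomic_part mu, diffuse_part mu).
Proof.
case: p => p1 p2 muC [/= p1ca p2pfa muE].
have {}muE E : mu E = p1 E + p2 E by exact: muE.
have aC := atomic_part_fa_measure muC.
have p1E E : p1 E = atomic_part mu E.
  apply/eqP; rewrite -subr_eq0 -mulN1r; apply/eqP.
  apply: (ca_points0 (ca_addZ (- 1) p1ca (tight_ca aC (atomic_part_tight muC)))).
  move=> x; rewrite mulN1r (atomic_part_finite muC (finite_set1 x)).
  by rewrite muE (pfa_set1 _ p2pfa) addr0 subrr.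
congr pair; apply/funext => E; first exact: p1E.
by rewrite /diffuse_part -p1E muE addrC addKr.
Qed.

Lemma ca_pfa_partsE mu : fa_measure mu ->
  ca_pfa_parts mu = (atomic_part mu, diffuse_part mu).
Proof.
move=> muC; rewrite /ca_pfa_parts.
have H : ca_pfa_decomposition mu (atomic_part mu, diffuse_part mu).
  split=> /=.
  - exact: tight_ca (atomic_part_fa_measure muC) (atomic_part_tight muC).
  - exact: diffuse_pfa (diffuse_part_fa_measure muC) (diffuse_part_set1 muC).
  - by move=> E _; rewrite /diffuse_part addrC subrK.
exact: decomposition_unique (xgetPex _ (ex_intro _ _ H)).
Qed.

Lemma tv_norm_fa_measure mu : fa_measure mu -> tv_norm mu = mu setT.
Proof.
move=> muC; rewrite /tv_norm; set S := (X in sup X).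
have S_le : ubound S (mu setT).
  move=> _ [n [F [_ tF ->]]].
  under eq_bigr do rewrite ger0_norm ?(proj2 muC)//.
  by rewrite -(fin_additive_bigsetU n (proj1 muC) tF); exact: fa_measure_le.
have S_muT : S (mu setT).
  exists 1%N, (bigcup2 setT set0); split => //.
  - by rewrite -trivIset_bigcup2 setI0.
  - by rewrite big_ord1/= ger0_norm// (proj2 muC).
apply/eqP; rewrite eq_le ge_sup//=; last by exists (mu setT).
by apply: ub_le_sup => //; exists (mu setT).
Qed.

(** If [F] carries [mu] up to [e / 2] and finite sets [G x] carry [K x] up to
    [t], then outside the union of the [G x] over [x] in [F] the kernel is at
    most [t] on [F] and at most [1] off [F]; integrating the bound
    [t + \1_(~` F)] gives at most [e].  This replaces exchanging two infinite
    sums of point masses. *)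
Lemma kernel_operator_tight (K : X -> set X -> R) mu : fa_measure mu -> tight mu ->
  (forall x, fa_measure (K x)) -> (forall x, K x setT <= 1) ->
  (forall x, tight (K x)) -> tight (kernel_operator K mu).
Proof.
move=> muC mu_tight KC K1 K_tight e e0.
have Kb x E : `|K x E| <= 1.
  exact: fa_measure_norm_le1.
have e20 : 0 < e / 2 by rewrite divr_gt0.
have [F fF Fe] := mu_tight _ e20.
have muT1 : 0 < mu setT + 1 by have := proj2 muC setT; lra.
(* the [+ 1] keeps the denominator positive when [mu] is zero *)
pose t := (e / 2) / (mu setT + 1).
have t0 : 0 < t by rewrite divr_gt0.
have /choice[G G_spec] : forall x, exists G, finite_set G /\ K x (~` G) <= t.
  by move=> x; have [G fG Gt] := K_tight x _ t0; exists G.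
exists (\bigcup_(x in F) G x).
  by apply: bigcup_finite => // x _; have [] := G_spec x.
have bt : `|t| <= t by rewrite ger0_norm ?(ltW t0).
have bi x : `|(\1_(~` F) : X -> R) x| <= 1.
  by rewrite indicE ger0_norm// lern1 leq_b1.
have bs x : `|((fun _ : X => t) \+ (\1_(~` F) : X -> R)) x| <= t + 1.
  exact: le_trans (ler_normD _ _) (lerD bt (bi x)).
rewrite /kernel_operator.
apply: (le_trans (radon_integral_le measurable_all muC (Kb^~ _) bs _)).
  move=> x /=; rewrite indicE; have [Fx|Fx] := pselect (F x).
    rewrite memNset ?addr0; last exact.
    have [_ Gt] := G_spec x; apply: le_trans Gt; apply: fa_measure_le => //.
    by move=> y nG Gy; apply: nG; exists x.
  rewrite mem_set//=.
  have := Kb x (~` \bigcup_(x in F) G x); rewrite ler_norml; move: (t0); lra.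
rewrite (radon_integralD measurable_all muC (M := t) (N := 1))//.
rewrite radon_integral_cst// radon_integral_indic// [leRHS]splitr lerD//.
by rewrite /t mulrAC ler_pdivrMr// ler_pM2l// lerDl.
Qed.

End discrete.

(** * Masses of the components along a combined chain *)

Theorem theorem5p1 (d : measure_display) (X : measurableType d) (R : realType)
    (hX : arbitrary_discrete_space X R)
    (P : X -> set X -> R) (q1 q2 : R)
    (hP : finitely_additive_markov_kernel P)
    (hcomb : combined P q1 q2) (hnd : non_degenerate q1 q2)
    (hA : kernel_operator (kernel_ca P) @` V_ (@pfa d X R) `<=` V_ (@ca d X R))
    (mu : nat -> set X -> R)
    (hmu1 : S_ba (mu 1%N))
    (hmuS : forall n : nat, (1 <= n)%N -> mu n.+1 = kernel_operator P (mu n))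
    (n : nat) (hn : (1 <= n)%N) :
  (tv_norm (ca_part (mu n.+1)) = ca_part (mu n.+1) [set: X] /\
   ca_part (mu n.+1) [set: X] = q1) /\
  (tv_norm (pfa_part (mu n.+1)) = pfa_part (mu n.+1) [set: X] /\
   pfa_part (mu n.+1) [set: X] = q2).
Proof.
have mE (E : set X) : measurable E by rewrite (space_discrete hX).
have PC x : fa_measure (P x).
  split; first exact: ba_fin_additive (kernel_ba hP x).
  by move=> E; have /andP[] := kernel_ge0_le1 hP x (mE E).
have PT x : P x setT = 1 by exact: kernel_setT.
have pT x : P x setT <= 1 by rewrite PT.
have kca : kernel_ca P = fun x => atomic_part (P x).
  apply/funext => x.
  by rewrite /kernel_ca /ca_part (ca_pfa_partsE mE (space_immeasurable hX)).
have kpfa : kernel_pfa P = fun x => diffuse_part (P x).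
  apply/funext => x.
  by rewrite /kernel_pfa /pfa_part (ca_pfa_partsE mE (space_immeasurable hX)).
have [_ _ q12 Pca Ppfa] := hcomb.
move: Pca Ppfa hA; rewrite {}kca {}kpfa => Pca Ppfa {}hA.
have mu_prob k : (1 <= k)%N -> fa_measure (mu k) /\ mu k setT = 1.
  elim: k => // -[_ _|k IH _].
    have [[mb m0 _] m1] := hmu1; split => //; split; first exact: ba_fin_additive.
    by move=> E; exact: m0.
  have [kC kT] := IH isT; rewrite hmuS//; split.
    exact: kernel_operator_fa_measure.
  rewrite /kernel_operator (_ : P ^~ setT = fun=> 1) ?radon_integral_cst ?mul1r//.
  exact/funext.
have [mC mT] := mu_prob n hn.
have [m1C _] := mu_prob n.+1 isT.
set m := mu n in mC mT.
pose K1 := fun x => atomic_part (P x); pose K2 := fun x => diffuse_part (P x).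
have K1C x : fa_measure (K1 x) by exact: atomic_part_fa_measure.
have K2C x : fa_measure (K2 x) by exact: diffuse_part_fa_measure.
have K1T x : K1 x setT <= 1.
  by rewrite -(PT x); exact: atomic_part_le.
have K2T x : K2 x setT <= 1.
  rewrite -(PT x) /K2 /diffuse_part gerBl; exact: (proj2 (K1C x)).
have K1b x E : `|K1 x E| <= 1.
  exact: fa_measure_norm_le1.
have K2b x E : `|K2 x E| <= 1.
  exact: fa_measure_norm_le1.
have AC1 : fa_measure (kernel_operator K1 m) by exact: kernel_operator_fa_measure.
have AC2 : fa_measure (kernel_operator K2 m) by exact: kernel_operator_fa_measure.
have aC := atomic_part_fa_measure mC; have dC := diffuse_part_fa_measure mC.
(* the hypothesis on the operator handles the diffuse part of [m] only *)
have A1ca : ca (kernel_operator K1 m).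
  have -> : kernel_operator K1 m = fun E => kernel_operator K1 (atomic_part m) E +
      1 * kernel_operator K1 (diffuse_part m) E.
    apply/funext => E; rewrite mul1r {1}(atomic_diffuseE m).
    by rewrite /kernel_operator (radon_integral_addmeasure _ aC dC (K1b^~ E)).
  apply: ca_addZ => //.
    apply: tight_ca => //; first exact: kernel_operator_fa_measure.
    apply: kernel_operator_tight => //; first exact: atomic_part_tight.
    by move=> x; exact: atomic_part_tight.
  have [] // : V_ (@ca d X R) (kernel_operator K1 (diffuse_part m)).
  apply: hA; exists (diffuse_part m) => //; split.
  - apply: (diffuse_pfa mE (space_immeasurable hX) dC).
    exact: diffuse_part_set1.
  - by move=> E _; exact: (proj2 dC).
  - rewrite /diffuse_part mT gerBl; exact: (proj2 aC).
have A2pfa : pfa (kernel_operator K2 m).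
  apply: (diffuse_pfa mE (space_immeasurable hX) AC2) => x; rewrite /kernel_operator.
  rewrite (_ : K2 ^~ [set x] = fun=> 0) ?radon_integral_cst ?mul0r//.
  by apply/funext => y; exact: diffuse_part_set1.
have dec : ca_pfa_decomposition (mu n.+1) (kernel_operator K1 m, kernel_operator K2 m).
  split => // E _; rewrite hmuS// /kernel_operator.
  rewrite -(radon_integralD mE mC (K1b^~ E) (K2b^~ E)); congr radon_integral.
  by apply/funext => x; rewrite {1}(atomic_diffuseE (P x)).
have parts := ca_pfa_partsE mE (space_immeasurable hX) m1C.
rewrite -(decomposition_unique mE (space_immeasurable hX) m1C dec) in parts.
rewrite /ca_part /pfa_part parts/= !tv_norm_fa_measure//.
rewrite /kernel_operator (_ : K1 ^~ setT = fun=> q1); last exact/funext.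
rewrite (_ : K2 ^~ setT = fun=> q2); last exact/funext.
by rewrite !radon_integral_cst// mT !mulr1.
Qed.
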